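(* Assume that the KKT solution set $\Omega^*$ is nonempty and that $$\mathcal P_f\succeq0,\quad \mathcal P_g\succeq0,\quad \mathcal P_f+\sigma A^*A\succ0,\quad \mathcal P_g+\sigma B^*B\succ0 .$$ Then the fixed-point set of the mapping $\mathbf T=(\mathcal M+\mathcal R_{ns})^{-1}(\mathcal M-\mathcal F_{sm})$ coincides with the KKT solution set: $$\operatorname{Fix}(\mathbf T):=\{w\in\mathbb H:\mathbf T(w)=w\}=\Omega^*.$$
   Context: **Setting.** $\mathbb X,\mathbb Y,\mathbb Z$ are finite-dimensional Euclidean spaces, each with an inner product $\langle\cdot,\cdot\rangle$ and induced norm $\|\cdot\|$; $\mathbb H:=\mathbb Y\times\mathbb Z\times\mathbb X$ carries the product inner product, with elements $w=(y,z,x)$. $p:\mathbb Y\to(-\infty,+\infty]$ and $q:\mathbb Z\to(-\infty,+\infty]$ are closed proper convex; $f:\mathbb Y\to\mathbb R$ and $g:\mathbb Z\to\mathbb R$ are convex and differentiable with Lipschitz continuous gradients; $A:\mathbb Y\to\mathbb X$, $B:\mathbb Z\to\mathbb X$ are linear with adjoints $A^*,B^*$; $c\in\mathbb X$. The problem is $\min_{y,z}\ p(y)+f(y)+q(z)+g(z)$ subject to $Ay+Bz=c$. For a self-adjoint linear operator $\Sigma$, $\|v\|_\Sigma^2:=\langle v,\Sigma v\rangle$; $\Sigma\succeq0$ (resp. $\succ0$) means positive semidefinite (resp. definite). **Majorization.** $\widehat\Sigma_f$ on $\mathbb Y$ and $\widehat\Sigma_g$ on $\mathbb Z$ are self-adjoint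 positive semidefinite linear operators such that for all $y,y'\in\mathbb Y$, $z,z'\in\mathbb Z$: $f(y)\le f(y')+\langle\nabla f(y'),y-y'\rangle+\tfrac12\|y-y'\|_{\widehat\Sigma_f}^2$ and $g(z)\le g(z')+\langle\nabla g(z'),z-z'\rangle+\tfrac12\|z-z'\|_{\widehat\Sigma_g}^2$. Let $\sigma>0$, let $\mathcal S$ on $\mathbb Y$ and $\mathcal T$ on $\mathbb Z$ be self-adjoint linear operators (not necessarily semidefinite), and set $\mathcal P_f:=\mathcal S+\widehat\Sigma_f$, $\mathcal P_g:=\mathcal T+\widehat\Sigma_g$. **Operators on $\mathbb H$.** With $\partial$ the convex subdifferential, $$\mathcal R_{ns}(w)=\begin{pmatrix}\partial p(y)+A^*x\\ \partial q(z)+B^*x\\ -Ay-Bz+c\end{pmatrix},\quad \mathcal F_{sm}(w)=\begin{pmatrix}\nabla f(y)\\ \nabla g(z)\\ 0\end{pmatrix},\quad \mathcal R=\mathcal R_{ns}+\mathcal F_{sm},$$ $$\mathcal M=\begin{pmatrix}\mathcal P_f+\sigma A^*A&0&A^*\\ 0&\mathcal P_g&0\\ A&0&\sigma^{-1}I\end{pmatrix}.$$ The KKT solution set is $\Omega^*:=\{w\in\mathbb H:0\in\mathcal R_{ns}(w)+\mathcal F_{sm}(w)\}$. **The mapping $\mathbf T$.** $\mathbf T(w)$ is the point $w^+\in\mathbb H$ with $\mathcal Mw-\mathcal F_{sm}(w)\in\mathcal Mw^++\mathcal R_{ns}(w^+)$; under the stated positive (semi)definiteness hypotheses such a $w^+$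 exists and is unique for every $w\in\mathbb H$, so $\mathbf T:\mathbb H\to\mathbb H$ is well defined. *)

(* Defs.v *)
From HB Require Import structures.
From mathcomp Require Import all_boot all_order all_algebra.
From mathcomp Require Import all_classical all_reals all_analysis.

Set Implicit Arguments.
Unset Strict Implicit.
Unset Printing Implicit Defensive.

Import Order.TTheory GRing.Theory Num.Theory.
Import numFieldNormedType.Exports.

Local Open Scope classical_set_scope.
Local Open Scope ring_scope.

(** Finite-dimensional Euclidean spaces: the norm (hence the topology) is the
    one induced by the inner product. *)
HB.mixin Record isEuclidean (R : realType) V
    of NormedModule R V & Vector R V := {
  dotp : {dot V for idfun} ;
  normE_dotp : forall v : V, `|v| = Num.sqrt (dotp v v)
}.

#[short(type="euclideanType")]
HB.structure Definition Euclidean (R : realType) :=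
  {V of NormedModule R V & Vector R V & isEuclidean R V}.

Notation "''[' u , v ]" := (dotp u v) : ring_scope.

Section LinearOperators.
Context {R : realType}.

(** The vector representing a linear form; a linear form on a euclideanType
    has exactly one such vector, so the default value 0 is irrelevant. *)
Definition riesz {V : euclideanType R} (phi : V -> R) : V :=
  xget 0 [set v | forall h, phi h = '[v, h]].

Definition adjoint {V W : euclideanType R} (A : V -> W) (x : W) : V :=
  riesz (fun v => '[A v, x]).

Definition self_adjoint {V : euclideanType R} (S : V -> V) : Prop :=
  forall u v, '[S u, v] = '[u, S v].

Definition sqnorm {V : euclideanType R} (S : V -> V) (v : V) : R :=
  '[v, S v].

Definition psd {V : euclideanType R} (S : V -> V) : Prop :=
  forall v, 0 <= sqnorm S v.

Definition pd {V : euclideanType R} (S : V -> V) : Prop :=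
  forall v, v != 0 -> 0 < sqnorm S v.

End LinearOperators.

Section ConvexFunctions.
Context {R : realType} {V : euclideanType R}.

Definition gradient (f : V -> R^o) (v : V) : V := riesz ('d f v).

(** Real-valued convex function with a Lipschitz continuous gradient. *)
Definition smooth_convex (f : V -> R^o) : Prop :=
  [/\ convex_function [set: convex_lmodType V] f,
      forall v, differentiable f v
    & lipschitz (gradient f)].

Local Open Scope ereal_scope.

(** Closedness of a proper function is lower semicontinuity; the value -oo is
    excluded, so the right-hand side of [cpc_convex] is never of the form
    +oo - oo, and 0 * +oo = 0. *)
Record closed_proper_convex (p : V -> \bar R) : Prop := {
  cpc_closed : lower_semicontinuous p ;
  cpc_gtNy : forall v, p v != -oo ;
  cpc_proper : exists v, p v != +oo ;
  cpc_convex : forall (t : {i01 R}) (u v : V),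
    p (t%:num *: u + (1 - t%:num) *: v)%R
      <= (t%:num)%:E * p u + (1 - t%:num)%:E * p v
}.

Definition subdifferential (p : V -> \bar R) (v : V) : set V :=
  [set s | forall u, p v + '[s, u - v]%R%:E <= p u].

(** [S] is a quadratic majorization operator of [f]. *)
Definition majorization (f : V -> R^o) (S : V -> V) : Prop :=
  forall u v : V,
    (f u <= f v + '[gradient f v, u - v] + 2^-1 * sqnorm S (u - v))%R.

End ConvexFunctions.

Section KKT.
Context {R : realType} {Y Z X : euclideanType R}.
Implicit Types (p : Y -> \bar R) (q : Z -> \bar R) (f : Y -> R^o)
  (g : Z -> R^o) (A : Y -> X) (B : Z -> X) (c : X).

Definition Rns p q A B c (w : Y * Z * X) : set (Y * Z * X) :=
  let: (y, z, x) := w in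
  [set (u + adjoint A x, v + adjoint B x, - A y - B z + c)
    | u in subdifferential p y & v in subdifferential q z].

Definition Fsm f g (w : Y * Z * X) : Y * Z * X :=
  let: (y, z, _) := w in (gradient f y, gradient g z, 0).

Definition kkt_set p q f g A B c : set (Y * Z * X) :=
  [set w | [set r + Fsm f g w | r in Rns p q A B c w] 0].

Definition Mop (sigma : R) A (Pf : Y -> Y) (Pg : Z -> Z) (w : Y * Z * X) :
    Y * Z * X :=
  let: (y, z, x) := w in
  (Pf y + sigma *: adjoint A (A y) + adjoint A x,
   Pg z,
   A y + sigma^-1 *: x).

(** The resolvent-type mapping (M + Rns)^-1 (M - Fsm). The default value 0 of
    [xget] would only be used where the inclusion has no solution. *)
Definition Tmap (sigma : R) p q f g A B c (Pf : Y -> Y) (Pg : Z -> Z)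
    (w : Y * Z * X) : Y * Z * X :=
  let M := Mop sigma A Pf Pg in
  xget 0 [set w' | [set M w' + r | r in Rns p q A B c w'] (M w - Fsm f g w)].

End KKT.

(* Main.v *)
(** If [T w = w], cancelling [M w] in the inclusion that defines [T w] leaves
    exactly the KKT inclusion, and conversely; so the point is that this
    inclusion has one and only one solution. Solving its third block for [x]
    turns it into a resolvent of the subdifferential of [q], preconditioned by
    [Pg + sigma B^* B], followed by one for [p], preconditioned by
    [Pf + sigma A^* A]. Uniqueness is monotonicity. For existence one minimizes
    [p] plus a positive definite quadratic; the affine minorant that makes this
    coercive comes from the subgradients in the assumed KKT point. Existence
    matters even for [Fix T] to lie in the KKT set: otherwise the default value
    [0] in [Tmap] could produce a spurious fixed point. *)

Require Import Defs.
From HB Require Import structures.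
From mathcomp Require Import all_boot all_order all_algebra.
From mathcomp Require Import all_classical all_reals all_analysis.
From mathcomp Require Import ring lra.

Set Implicit Arguments.
Unset Strict Implicit.
Unset Printing Implicit Defensive.

Import Order.TTheory GRing.Theory Num.Theory.
Import numFieldNormedType.Exports.

Local Open Scope classical_set_scope.
Local Open Scope ring_scope.

(** * Inner products, adjoints and coordinates *)

Section InnerProduct.
Context {R : realType}.
Implicit Types V W : euclideanType R.

Lemma dotpC V (u v : V) : '[u, v] = '[v, u].
Proof. by have := hermC (dotp (s := V)) u v; rewrite expr0 mul1r. Qed.

Lemma dotpDl V (u v w : V) : '[u + v, w] = '[u, w] + '[v, w].
Proof. exact: linearDl. Qed.

Lemma dotpDr V (u v w : V) : '[w, u + v] = '[w, u] + '[w, v].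
Proof. exact: linearDr. Qed.

Lemma dotpBl V (u v w : V) : '[u - v, w] = '[u, w] - '[v, w].
Proof. exact: linearBl. Qed.

Lemma dotpZl V a (u v : V) : '[a *: u, v] = a * '[u, v].
Proof. exact: linearZl_LR. Qed.

Lemma dotpZr V a (u v : V) : '[u, a *: v] = a * '[u, v].
Proof. exact: linearZr_LR. Qed.

Lemma dotp_gt0 V (v : V) : v != 0 -> 0 < '[v, v].
Proof. exact: neq0_dnorm_gt0. Qed.

Lemma dotp_ge0 V (v : V) : 0 <= '[v, v].
Proof.
have [->|/dotp_gt0/ltW//] := eqVneq v 0.
by rewrite linear0l.
Qed.

Lemma dotp_eq0 V (v : V) : '[v, v] = 0 -> v = 0.
Proof. by move=> v0; apply: contra_eq v0 => /dotp_gt0; rewrite lt0r => /andP[]. Qed.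

Lemma dotpNl V (u v : V) : '[- u, v] = - '[u, v].
Proof. exact: linearNl. Qed.

Lemma dotpNr V (u v : V) : '[u, - v] = - '[u, v].
Proof. exact: linearNr. Qed.

Lemma dotp_sumr V I (r : seq I) (u : V) (F : I -> V) :
  '[u, \sum_(i <- r) F i] = \sum_(i <- r) '[u, F i].
Proof. exact: (linear_sumr (dotp (s := V)) u). Qed.

Lemma dotp_inj V (u v : V) : (forall w, '[u, w] = '[v, w]) -> u = v.
Proof.
move=> uv; apply/eqP; rewrite -subr_eq0; apply/eqP/dotp_eq0.
by rewrite dotpBl uv subrr.
Qed.

Lemma injective_linear_surj V (L : {linear V -> V}) b :
  (forall v, L v = 0 -> v = 0) -> exists v, L v = b.
Proof.
move=> L0; have ker0 : lker (linfun L) == 0%VS.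
  rewrite -subv0; apply/subvP => v; rewrite memv_ker lfunE /= memv0.
  by move=> /eqP/L0->.
have : b \in limg (linfun L) by rewrite lker0_limgf // memvf.
by move=> /memv_imgP[v _ ->]; exists v; rewrite lfunE.
Qed.

(** The Gram map [L] of a basis is injective, since a vector orthogonal to the whole basis is
    orthogonal to itself; hence it reaches the vector whose coordinates are the values of [phi] on
    the basis. *)
Lemma riesz_exists V (phi : {scalar V}) : exists v, forall h, phi h = '[v, h].
Proof.
pose e := vbasis (@fullv _ V).
have expand u : u = \sum_i coord e i u *: e`_i.
  exact: coord_vbasis (memvf u).
pose L v : V := \sum_(i < \dim (@fullv _ V)) '[v, e`_i] *: e`_i.
have linL : linear L.
  move=> a u v; rewrite /L scaler_sumr -big_split /=; apply: eq_bigr => i _.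
  by rewrite dotpDl dotpZl scalerDl scalerA.
pose LL : {linear V -> V} := HB.pack L (GRing.isLinear.Build _ _ _ _ L linL).
have free_e : free e by apply: basis_free (vbasisP _).
have coordL (a : 'I_(\dim (@fullv _ V)) -> R) i :
  coord e i (\sum_j a j *: e`_j) = a i by rewrite coord_sum_free.
have [v Lv] : exists v, LL v = \sum_(i < \dim (@fullv _ V)) phi e`_i *: e`_i.
  apply: injective_linear_surj => v Lv0; apply: dotp_eq0.
  rewrite {2}(expand v) dotp_sumr big1 // => i _; rewrite dotpZr.
  have := coordL (fun i => '[v, e`_i]) i.
  by rewrite -/(L v) (Lv0 : L v = 0) linear0 => <-; rewrite mulr0.
exists v => h; rewrite {1}(expand h) {2}(expand h) linear_sum dotp_sumr.
apply: eq_bigr => i _; rewrite linearZ dotpZr; congr (_ * _) => /=.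
have := coordL (fun i => '[v, e`_i]) i.
by rewrite -/(L v) (Lv : L v = _) coordL.
Qed.

(** By [riesz_exists], [xget] picks a genuine representing vector and not its default. *)
Lemma adjointE V W (A : {linear V -> W}) x v : '[v, adjoint A x] = '[A v, x].
Proof.
have lin : scalar (fun v => '[A v, x]).
  by move=> a u w; rewrite linearP dotpDl dotpZl.
pose phi : {scalar V} :=
  HB.pack (fun v => '[A v, x]) (GRing.isLinear.Build _ _ _ _ _ lin).
have [y yE] := riesz_exists phi.
by rewrite dotpC -(xgetI (P := [set y | forall v, phi v = '[y, v]]) 0 yE v).
Qed.

Lemma adjoint_is_linear V W (A : {linear V -> W}) : linear (adjoint A).
Proof.
move=> a x y; apply: dotp_inj => v.
rewrite dotpDl dotpZl !(dotpC (adjoint A _)) !adjointE.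
by rewrite dotpDr dotpZr.
Qed.

HB.instance Definition _ V W (A : {linear V -> W}) :=
  GRing.isLinear.Build R W V _ (adjoint A) (adjoint_is_linear A).

(** The [g i] represent the coordinate forms, which turns coordinates into inner products. *)
Lemma dual_basis V : exists n (e g : 'I_n -> V),
  forall v, v = \sum_i '[g i, v] *: e i.
Proof.
pose b := vbasis (@fullv _ V).
exists (\dim (@fullv _ V)), (fun i => b`_i).
have /choice[g gE] i := riesz_exists (coord b i : {scalar V}).
exists g => v; rewrite {1}(coord_vbasis (memvf v)).
by apply: eq_bigr => i _; rewrite -gE.
Qed.

(** Polarization reduces this to continuity of the norm. *)
Lemma dotp_continuous V (v : V) : continuous (fun u => '[v, u]).
Proof.
have -> : (fun u => '[v, u]) =
    (fun u => 2^-1 * (`|v + u| ^+ 2 - `|v| ^+ 2 - `|u| ^+ 2)).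
  apply/funext => u; rewrite !normE_dotp !sqr_sqrtr ?dotp_ge0//.
  by rewrite dotpDl !dotpDr (dotpC u v); field.
move=> u; apply: cvgM; first exact: cvg_cst.
apply: cvgB; first apply: cvgB; last 2 first.
- exact: cvg_cst.
- by rewrite expr2; apply: cvgM; apply: cvg_norm; exact: cvg_id.
rewrite expr2; apply: cvgM; apply: cvg_norm;
  (apply: cvgD; [exact: cvg_cst|exact: cvg_id]).
Qed.

(** Expanding only one of the two copies of [v] leaves a finite sum of products of linear forms. *)
Lemma quadratic_continuous V (L : {linear V -> V}) :
  continuous (fun v => '[v, L v]).
Proof.
have [n [e [g eg]]] := dual_basis V.
have -> : (fun v => '[v, L v]) =
    (fun v => \sum_i '[g i, v] * '[L (e i), v]).
  apply/funext => v; rewrite {2}(eg v) linear_sum dotp_sumr.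
  by apply: eq_bigr => i _; rewrite linearZ dotpZr (dotpC v).
move=> v; apply: cvg_big => [|i _]; first exact: add_continuous.
by apply: cvgM; exact: dotp_continuous.
Qed.

Lemma bounded_coordinates_compact V n (e : 'I_n -> V) (M : 'I_n -> R) :
  compact [set \sum_i a i *: e i | a in [set a | forall i, `|a i| <= M i]].
Proof.
have -> : [set \sum_i a i *: e i | a in [set a | forall i, `|a i| <= M i]] =
    (fun w : 'rV[R]_n => \sum_i w ord0 i *: e i) @`
      [set w : 'rV[R]_n | forall i, `[- M i, M i]%classic (w ord0 i)].
  apply/seteqP; split=> _ /= [a aM <-].
    exists (\row_i a i); last by apply: eq_bigr => i _; rewrite mxE.
    by move=> i; rewrite mxE in_itv/= -ler_norml.
  by exists (a ord0) => // i; have := aM i; rewrite in_itv/= -ler_norml.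
apply: continuous_compact; last first.
  apply: (@rV_compact _ _ (fun i => `[- M i, M i]%classic)) => i.
  exact: segment_compact.
apply: continuous_subspaceT.
apply: continuous_big => [|i _ w]; first exact: add_continuous.
exact: (cvgZr_tmp (F := nbhs w) (a := e i) (@coord_continuous R 1 n ord0 i w)).
Qed.

End InnerProduct.

(** * Minimization of lower semicontinuous functions *)

Section LowerSemicontinuous.
Context {R : realType} {T : topologicalType}.
Implicit Types f : T -> \bar R.
Local Open Scope ereal_scope.

(** The sublevel sets in [K] at values taken on [K] form a chain, hence a filter base. Compactness
    gives a cluster point in [K], and lower semicontinuity makes it a minimizer. *)
Lemma lower_semicontinuous_attains_min f (K : set T) :
  lower_semicontinuous f -> compact K -> K !=set0 ->
  exists2 x, K x & forall y, K y -> f x <= f y.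
Proof.
move=> lscf cK [x0 Kx0].
pose F := filter_from K (fun y => K `&` [set x | f x <= f y]).
have FF : Filter F.
  apply: filter_from_filter; first by exists x0.
  move=> y z Ky Kz; have [yz|/ltW zy] := leP (f y) (f z).
    exists y => // x [Kx fxy]; split; split=> //=.
    exact: le_trans fxy yz.
  exists z => // x [Kx fxz]; split; split=> //=.
  exact: le_trans fxz zy.
have PF : ProperFilter F.
  by apply: filter_from_proper => y Ky; exists y; split=> //=.
have FK : F K by exists x0 => // x [].
have [x [Kx clx]] := cK F PF FK.
exists x => // y Ky; rewrite leNgt; apply/negP => fyx.
(* Lower semicontinuity is tested at real levels, so a real number has to separate the two extended
   values. *)
have [a fya afx] : exists2 a, f y <= a%:E & a%:E < f x.
  move: fyx; case: (f y) => [r rx||].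
  - by exists r.
  - by rewrite ltNge leey.
  - case: (f x) => [s _|_|]; last by rewrite ltxx.
      by exists (s - 1)%R; rewrite ?leNye// lte_fin ltrBlDr ltrDl.
    by exists 0%R; rewrite ?leNye ?ltry.
have [V xV aV] := lscf _ _ afx.
have Fy : F (K `&` [set x | f x <= f y]) by exists y.
have [z [[_ /= fzy] /aV]] := clx _ _ Fy xV.
by rewrite ltNge (le_trans fzy fya).
Qed.

Lemma lower_semicontinuousD f (h : T -> R) :
  lower_semicontinuous f -> continuous h ->
  lower_semicontinuous (fun x => f x + (h x)%:E).
Proof.
move=> lscf ch x a afx.
(* For finite [f x], the midpoint of [a - h x] and [f x] leaves slack for both summands. *)
have [r rfx arh] : exists2 r, r%:E < f x & (a < r + h x)%R.
  move: afx; case: (f x) => [s||//].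
    rewrite -EFinD lte_fin => ash.
    by exists ((s + (a - h x)) / 2)%R; rewrite ?lte_fin; lra.
  by move=> _; exists (a - h x + 1)%R; rewrite ?ltry//; lra.
have [V xV rV] := lscf _ _ rfx.
have xW : nbhs x [set y | (a < r + h y)%R].
  have : (h y @[y --> x] --> h x)%classic by exact: ch.
  move=> /cvgrPdist_lt /(_ (r + h x - a)%R); rewrite subr_gt0 => /(_ arh).
  apply: filterS => y /=; rewrite ltr_norml => /andP[_ ?]; lra.
exists (V `&` [set y | (a < r + h y)%R]); first exact: filterI.
move=> y [/rV rfy /= arhy]; apply: (@lt_trans _ _ (r%:E + (h y)%:E)).
  by rewrite -EFinD lte_fin.
by rewrite lteD2rE.
Qed.

End LowerSemicontinuous.

(** * Preconditioned resolvents of subdifferentials *)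

Section Resolvent.
Context {R : realType} {V : euclideanType R}.
Implicit Types (p : V -> \bar R) (L : {linear V -> V}).
Local Open Scope ereal_scope.

Lemma subdifferential_fin_num p y s :
  closed_proper_convex p -> subdifferential p y s -> p y \is a fin_num.
Proof.
move=> [_ pNy [v pv] _] /(_ v); rewrite fin_numE pNy /=.
by apply: contraTN => /eqP ->; rewrite addye// leye_eq.
Qed.

(** Add the two subgradient inequalities, each tested at the other point; the values of [p] are
    finite and cancel. *)
Lemma subdifferential_monotone p y1 y2 s1 s2 : closed_proper_convex p ->
  subdifferential p y1 s1 -> subdifferential p y2 s2 ->
  (0 <= '[s1 - s2, y1 - y2])%R.
Proof.
move=> cpc_p s1y1 s2y2.
have p1 := subdifferential_fin_num cpc_p s1y1.
have p2 := subdifferential_fin_num cpc_p s2y2.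
have := s2y2 y1; have := s1y1 y2.
rewrite -(fineK p1) -(fineK p2) -!EFinD !lee_fin.
rewrite dotpBl -(opprB y1 y2) dotpNr; lra.
Qed.

Lemma pd_eq0 L v : pd L -> '[v, L v] = 0%R -> v = 0%R.
Proof. by move=> pdL; apply: contra_eq => /pdL; rewrite lt0r => /andP[]. Qed.

Lemma resolvent_unique p L y1 y2 s1 s2 : closed_proper_convex p -> pd L ->
  subdifferential p y1 s1 -> subdifferential p y2 s2 ->
  (s1 + L y1 = s2 + L y2)%R -> y1 = y2.
Proof.
move=> cpc_p pdL s1y1 s2y2 eqsL.
have := subdifferential_monotone cpc_p s1y1 s2y2.
have -> : (s1 - s2 = - L (y1 - y2))%R.
  rewrite -[s1](addrK (L y1)) eqsL linearB opprB.
  by rewrite -(addrA s2) (addrC s2) addrK.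
rewrite dotpNl oppr_ge0 => le0; apply/eqP; rewrite -subr_eq0.
apply: contraTT le0 => /pdL; rewrite -ltNge dotpC; exact.
Qed.

(* With L a' = s + b + L y0 and d = u - y0 + a', the objective is at most its
   value at y0 only if <d, L d> <= <a', L a'>; a coordinate of d has the form
   <k, L d>, hence is bounded by (<k, L k> + <d, L d>) / 2. *)
Lemma quadratic_perturbation_min p L b y0 s : closed_proper_convex p ->
  self_adjoint L -> pd L -> subdifferential p y0 s ->
  let h u := ('[b, u] + 2^-1 * '[u, L u])%R in
  exists y, forall u, p y + (h y)%:E <= p u + (h u)%:E.
Proof.
move=> cpc_p L_sa pdL s_y0 h.
have Lsurj a : exists v, L v = a.
  apply: injective_linear_surj => v Lv; apply: (pd_eq0 pdL).
  by rewrite Lv linear0r.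
have LD x y : (L (x + y) = L x + L y)%R := linearD L x y.
have LN x : (L (- x) = - L x)%R := linearN L x.
have sym x y : '[x, L y] = '[y, L x] by rewrite -L_sa dotpC.
have psdL v : (0 <= '[v, L v])%R.
  have [->|/pdL/ltW//] := eqVneq v 0%R; by rewrite linear0l.
have [n [e [g eg]]] := dual_basis V.
have [a' La'] := Lsurj (s + b + L y0)%R.
have /choice[k gk] i := Lsurj (g i).
pose C := '[a', L a'].
pose M i := (2^-1 * ('[k i, g i] + C) + `|'[g i, y0 - a']|)%R.
have bound u : p u + (h u)%:E <= p y0 + (h y0)%:E ->
    forall i, (`|'[g i, u]| <= M i)%R.
  move=> le_u i.
  have p0 := subdifferential_fin_num cpc_p s_y0.
  have [d uE] : exists d, u = (d - a' + y0)%R.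
    by exists (u - y0 + a')%R; rewrite addrK subrK.
  have dC : ('[d, L d] <= C)%R.
    have : p y0 + '[s, u - y0]%:E + (h u)%:E <= p y0 + (h y0)%:E.
      by apply: le_trans le_u; apply: leeD2r; exact: s_y0.
    rewrite -(fineK p0) -!EFinD lee_fin /h uE.
    have sE : s = (L a' - b - L y0)%R.
      by rewrite La' addrAC !addrK.
    rewrite addrK sE /C.
    rewrite !(LD, LN) !(dotpDr, dotpDl, dotpNr, dotpNl) !L_sa.
    rewrite (sym d a') (sym d y0) (sym a' y0); lra.
  have kd x : (2 * '[x, L d] <= '[x, L x] + '[d, L d])%R.
    have := psdL (x - d)%R.
    rewrite LD LN !(dotpDr, dotpDl, dotpNr, dotpNl) (sym d x); lra.
  have := kd (k i); have := kd (- k i)%R.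
  rewrite !dotpNl LN dotpNr opprK -L_sa gk => k1 k2.
  have gd : (`|'[g i, d]| <= 2^-1 * ('[k i, g i] + C))%R.
    by rewrite ler_norml; lra.
  by rewrite uE addrAC -addrA dotpDr (le_trans (ler_normD _ _))// lerD2r.
(* A compact set containing the sublevel set through [y0]; outside that sublevel set [y0] itself
   does better. *)
pose K := [set \sum_i a i *: e i | a in [set a | forall i, `|a i| <= M i]]%R.
have inK u : p u + (h u)%:E <= p y0 + (h y0)%:E -> K u.
  by move=> /bound uM; exists (fun i => '[g i, u]).
have ch : continuous h.
  move=> u; apply: cvgD; first exact: dotp_continuous.
  apply: cvgM; [exact: cvg_cst|exact: quadratic_continuous].
have Ky0 : K y0 by apply: inK.
have [y Ky ymin] := lower_semicontinuous_attains_min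
  (lower_semicontinuousD (cpc_closed cpc_p) ch)
  (@bounded_coordinates_compact R V n e M) (ex_intro _ _ Ky0).
exists y => u; have [/inK/ymin//|/ltW] := leP (p u + (h u)%:E) (p y0 + (h y0)%:E).
exact: le_trans (ymin _ Ky0).
Qed.

(** Compare [y] with points [y + t d] on the segment towards [u]. By convexity the change of [p] is
    at most linear in [t], so after division by [t] the only term left with a factor [t] is the
    quadratic one. *)
Lemma quadratic_perturbation_opt p L b y : closed_proper_convex p ->
  self_adjoint L -> pd L ->
  let h u := ('[b, u] + 2^-1 * '[u, L u])%R in
  (forall u, p y + (h y)%:E <= p u + (h u)%:E) ->
  subdifferential p y (- (b + L y))%R.
Proof.
move=> [_ pNy [v0 pv0] pconv] L_sa pdL h ymin.
have py : p y \is a fin_num.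
  rewrite fin_numE pNy /=; apply/eqP => pyy.
  have /fineK v0E : p v0 \is a fin_num by rewrite fin_numE pNy.
  by have := ymin v0; rewrite pyy addye// leye_eq -v0E.
move=> u /=; have [->|puy] := eqVneq (p u) +oo; first exact: leey.
have pu : p u \is a fin_num by rewrite fin_numE pNy.
have [d dE] : exists d, (u - y = d)%R by exists (u - y)%R.
pose Q := '[d, L d].
have Q0 : (0 <= Q)%R.
  by rewrite /Q; have [->|/pdL/ltW//] := eqVneq d 0%R; rewrite linear0l.
(* The defect in the subgradient inequality at [u]: the goal amounts to [X <= 0]. *)
pose X := (fine (p y) - fine (p u) - '[b + L y, d])%R.
have small (t : R) : (0 < t)%R -> (t <= 1)%R -> (X <= 2^-1 * t * Q)%R.
  move=> t0 t1.
  pose t' : {i01 R} := Itv01 (ltW t0) t1.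
  have := ymin (t *: u + (1 - t) *: y)%R.
  move=> /le_trans /(_ (leeD2r _ (pconv t' u y))) /=.
  have -> : (t *: u + (1 - t) *: y = y + t *: d)%R.
    by rewrite -dE scalerBl scale1r scalerBr addrCA.
  rewrite -(fineK pu) -(fineK py) -!EFinM -!EFinD lee_fin /h.
  rewrite (linearD L) (linearZZ L) !(dotpDr, dotpDl, dotpZl, dotpZr).
  rewrite -(L_sa y d) (dotpC d (L y)) => le_t.
  have : (t * X <= t * (2^-1 * t * Q))%R.
    by rewrite /X /Q dotpDl; lra.
  by rewrite ler_pM2l.
have X0 : (X <= 0)%R.
  rewrite leNgt; apply/negP => Xgt0.
  have XQ : (0 < X + Q)%R by rewrite ltr_pwDl.
  (* This [t] replaces the limit at 0: the bound becomes [X <= X * Q / (2 * (X + Q))], impossible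
     for [X > 0] and [Q >= 0]. *)
  have := small (X / (X + Q))%R.
  rewrite divr_gt0// ler_pdivrMr// mul1r lerDl => /(_ isT Q0).
  rewrite (_ : 2^-1 * (X / (X + Q)) * Q = X * Q / (2 * (X + Q)))%R; last first.
    by field; rewrite gt_eqF.
  rewrite ler_pdivlMr ?mulr_gt0//; nra.
rewrite -(fineK pu) -(fineK py) -EFinD lee_fin dE dotpNl.
by move: X0; rewrite /X; lra.
Qed.

(** With linear term [- m], optimality makes [m - L y] a subgradient at the minimizer [y]. *)
Lemma resolvent_exists p L m y0 s : closed_proper_convex p ->
  self_adjoint L -> pd L -> subdifferential p y0 s ->
  exists y s', subdifferential p y s' /\ (s' + L y = m)%R.
Proof.
move=> cpc_p L_sa pdL s_y0.
have [y ymin] := quadratic_perturbation_min (- m)%R cpc_p L_sa pdL s_y0.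
exists y, (- (- m + L y))%R; split; last by rewrite opprD opprK subrK.
exact: quadratic_perturbation_opt ymin.
Qed.

End Resolvent.

(** * The block inclusion for [Mop] and [Rns] *)

Lemma self_adjoint_gram {R : realType} {V W : euclideanType R} (sigma : R)
  (S : {linear V -> V}) (A : {linear V -> W}) :
  self_adjoint S -> self_adjoint (S \+ sigma \*: (adjoint A \o A)).
Proof.
move=> S_sa u v /=; rewrite dotpDl dotpDr dotpZl dotpZr S_sa.
by rewrite (dotpC (adjoint A _)) !adjointE (dotpC (A v)).
Qed.

Lemma self_adjointD {R : realType} {V : euclideanType R} (S T : V -> V) :
  self_adjoint S -> self_adjoint T -> self_adjoint (S \+ T).
Proof. by move=> S_sa T_sa u v /=; rewrite dotpDl dotpDr S_sa T_sa. Qed.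

Section ProximalStep.
Context {R : realType} {X Y Z : euclideanType R}.
Context (p : Y -> \bar R) (q : Z -> \bar R) (A : {linear Y -> X})
  (B : {linear Z -> X}) (c : X) (Pf : {linear Y -> Y}) (Pg : {linear Z -> Z})
  (sigma : R).
Context (hp : closed_proper_convex p) (hq : closed_proper_convex q)
  (sigma_gt0 : 0 < sigma) (Pf_sa : self_adjoint Pf) (Pg_sa : self_adjoint Pg)
  (PfA_pd : pd (fun y => Pf y + sigma *: adjoint A (A y)))
  (PgB_pd : pd (fun z => Pg z + sigma *: adjoint B (B z))).

Let LA : {linear Y -> Y} := Pf \+ sigma \*: (adjoint A \o A).
Let LB : {linear Z -> Z} := Pg \+ sigma \*: (adjoint B \o B).

(* Solving the third block row for x decouples the inclusion into a resolvent
   in z followed by a resolvent in y. *)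
Lemma MRns_eqP y z x u v m1 m2 m3 :
  Mop sigma A Pf Pg (y, z, x) +
    (u + adjoint A x, v + adjoint B x, - A y - B z + c) = (m1, m2, m3) <->
  [/\ x = sigma *: (m3 + B z - c),
      v + LB z = m2 - sigma *: adjoint B (m3 - c)
    & u + LA y = m1 - adjoint A x - adjoint A x].
Proof.
have s0 : sigma != 0 by rewrite gt_eqF.
have add3 (a1 b1 : Y) (a2 b2 : Z) (a3 b3 : X) :
  (a1, a2, a3) + (b1, b2, b3) = (a1 + b1, a2 + b2, a3 + b3) by [].
(* [A y] from [Mop] cancels [- A y] from [Rns], so the third block gives [x] in terms of [z]
   alone. *)
have xE : A y + sigma^-1 *: x + (- A y - B z + c) = m3 <->
    x = sigma *: (m3 + B z - c).
  split=> [<-|->]; apply: dotp_inj => w;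
    by rewrite !(dotpDl, dotpNl, dotpZl); field.
(* Inserting [x] into the second block produces the Gram term that completes [Pg] to [LB]. *)
have BxE : adjoint B (sigma *: (m3 + B z - c)) =
    sigma *: adjoint B (m3 - c) + sigma *: adjoint B (B z).
  by rewrite linearZZ addrAC linearD scalerDr.
rewrite /= add3; split=> [[e1 e2 /xE e3]|[e3 e2 e1]].
  split=> //; apply: dotp_inj => w.
    rewrite -e2 e3 BxE /=; rewrite !(dotpDl, dotpNl, dotpZl); ring.
  (* One copy of [adjoint A x] comes from [Mop], the other from [Rns]. *)
  by rewrite -e1 /=; rewrite !(dotpDl, dotpNl, dotpZl); ring.
congr (_, _, _); last exact/xE; apply: dotp_inj => w.
  have := congr1 (fun v => '[v, w]) e1; rewrite /= !(dotpDl, dotpNl, dotpZl).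
  lra.
have := congr1 (fun v => '[v, w]) e2; rewrite /= e3 BxE.
rewrite !(dotpDl, dotpNl, dotpZl); lra.
Qed.

Let resolvent m : set (Y * Z * X) :=
  [set w | [set Mop sigma A Pf Pg w + r | r in Rns p q A B c w] m].

(** The system is triangular: [z] is determined first, then [x], then [y]. *)
Lemma MRns_inverse_unique m : is_subset1 (resolvent m).
Proof.
case: m => [[m1 m2] m3] [[y z] x] [[y' z'] x'].
move=> [_ [u hu [v hv <-]]] /MRns_eqP[xE vE uE].
move=> [_ [u' hu' [v' hv' <-]]] /MRns_eqP[xE' vE' uE'].
have zz : z = z'.
  by apply: (resolvent_unique hq (L := LB) PgB_pd hv hv'); rewrite vE vE'.
have xx : x = x' by rewrite xE xE' zz.
have yy : y = y'.
  by apply: (resolvent_unique hp (L := LA) PfA_pd hu hu'); rewrite uE uE' xx.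
by rewrite xx yy zz.
Qed.

(** The given subgradients are unrelated to [m]; they supply affine minorants of [p] and [q]. *)
Lemma MRns_inverse_exists m y0 z0 u0 v0 :
  subdifferential p y0 u0 -> subdifferential q z0 v0 -> resolvent m !=set0.
Proof.
case: m => [[m1 m2] m3] hu0 hv0.
have [z [v [hv vE]]] := resolvent_exists (L := LB)
  (m2 - sigma *: adjoint B (m3 - c)) hq (self_adjoint_gram sigma B Pg_sa) PgB_pd hv0.
pose x := sigma *: (m3 + B z - c).
have [y [u [hu uE]]] := resolvent_exists (L := LA)
  (m1 - adjoint A x - adjoint A x) hp (self_adjoint_gram sigma A Pf_sa) PfA_pd hu0.
exists (y, z, x), (u + adjoint A x, v + adjoint B x, - A y - B z + c).
  by exists u => //; exists v.
exact/MRns_eqP.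
Qed.

End ProximalStep.

(** * Fixed points and KKT points *)

Theorem theorem2p4 (R : realType) (X Y Z : euclideanType R)
  (p : Y -> \bar R) (q : Z -> \bar R) (f : Y -> R^o) (g : Z -> R^o)
  (A : {linear Y -> X}) (B : {linear Z -> X}) (c : X)
  (Sf S : {linear Y -> Y}) (Sg T : {linear Z -> Z}) (sigma : R)
  (hp : closed_proper_convex p) (hq : closed_proper_convex q)
  (hf : smooth_convex f) (hg : smooth_convex g)
  (hSf : self_adjoint Sf) (hSf0 : psd Sf) (hfSf : majorization f Sf)
  (hSg : self_adjoint Sg) (hSg0 : psd Sg) (hgSg : majorization g Sg)
  (hsigma : 0 < sigma)
  (hS : self_adjoint S) (hT : self_adjoint T)
  (hkkt : kkt_set p q f g A B c !=set0)
  (hPf : psd (S \+ Sf)) (hPg : psd (T \+ Sg))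
  (hPfA : pd (fun y => (S \+ Sf) y + sigma *: adjoint A (A y)))
  (hPgB : pd (fun z => (T \+ Sg) z + sigma *: adjoint B (B z))) :
  [set w | Tmap sigma p q f g A B c (S \+ Sf) (T \+ Sg) w = w]
  = kkt_set p q f g A B c.
Proof.
have Pf_sa := self_adjointD hS hSf; have Pg_sa := self_adjointD hT hSg.
have kktE w : kkt_set p q f g A B c w <->
    [set Mop sigma A (S \+ Sf) (T \+ Sg) w + r | r in Rns p q A B c w]
      (Mop sigma A (S \+ Sf) (T \+ Sg) w - Fsm f g w).
  split=> -[r rw rE]; exists r => //.
    by congr (_ + _); apply/eqP; rewrite -addr_eq0 rE.
  by move: rE => /addrI ->; rewrite addNr.
have [[[y0 z0] x0] [_ [u0 hu0 [v0 hv0 _]] _]] := hkkt.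
apply/seteqP; split=> w /=.
  move=> Tw; apply/kktE.
  (* A solution exists, so [xget] returns one, and by [Tw] it is [w]. *)
  have /(xgetPex 0) := MRns_inverse_exists c hp hq hsigma Pf_sa Pg_sa hPfA hPgB
    (Mop sigma A (S \+ Sf) (T \+ Sg) w - Fsm f g w) hu0 hv0.
  by rewrite [xget _ _]Tw.
move=> /kktE Mw; rewrite /Tmap; apply: xget_subset1; first exact: Mw.
exact: (MRns_inverse_unique hp hq hsigma hPfA hPgB).
Qed.
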